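(* Let $X$ and $P$ be nonempty complete metric spaces and let $F:X\times P\to X$ satisfy the following conditions: (a) $F$ is Lipschitz in $x$ uniformly on bounded sets of $P$, i.e. for every bounded set $B\subset P$ there exists $L\ge 0$ such that $d(F(x,u),F(y,u))\le L\,d(x,y)$ for all $x,y\in X$ and all $u\in B$. (b) $F$ is an eventual contraction in $x$ uniformly on bounded sets of $P$, i.e. for every bounded set $B\subset P$ there exist a natural number $N\ge 1$ and a constant $0\le C<1$ such that $d(F_u^N(x),F_u^N(y))\le C\,d(x,y)$ for all $x,y\in X$ and all $u\in B$, where $F_u^N$ is the $N$-fold iterate of $F_u:=F(\cdot,u):X\to X$. (c) For every $x\in X$ the map $F_x:P\to X$, $u\mapsto F(x,u)$, is continuous. (d) For every $x\in X$ the map $F_x:P\to X$ is compact. Then the fixed point map $\Phi:P\to X$, which assigns to each $u\in P$ the unique fixed point of $F_u$, i.e. $\Phi(u)=F(\Phi(u),u)$, is well-defined, continuous and compact. If additionally (e) $F$ is locally Lipschitz in $u$ locally uniformly in $x$, then $\Phi:P\to X$ is also locally Lipschitz.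
   Context: All metrics are denoted by $d$. A subset $S$ of a metric space is bounded if there is $r\ge 0$ with $d(x,y)\le r$ for all $x,y\in S$ (boundedness is always in the metric sense). A map $H:P\to Z$ between metric spaces is called compact if it maps bounded sets of $P$ to relatively compact sets of $Z$ (sets with compact closure); compact maps are not assumed continuous. A map $H:P\to Z$ is locally Lipschitz if every $u_0\in P$ has a neighborhood $V$ for which there is $L\ge 0$ with $d(H(v),H(w))\le L\,d(v,w)$ for all $v,w\in V$. The map $F:X\times P\to X$ is locally Lipschitz in $u$ locally uniformly in $x$ if for every $x_0\in X$ and $u_0\in P$ there exist neighborhoods $U\subset X$ of $x_0$ and $V\subset P$ of $u_0$ and a constant $L\ge 0$ such that $d(F(x,v),F(x,w))\le L\,d(v,w)$ for all $x\in U$ and all $v,w\in V$. *)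

(* Defs.v *)
From HB Require Import structures.
From mathcomp Require Import all_boot all_order all_algebra.
From mathcomp Require Import all_classical all_reals all_analysis.

Set Implicit Arguments.
Unset Strict Implicit.
Unset Printing Implicit Defensive.

Import Order.TTheory GRing.Theory Num.Theory.

Local Open Scope classical_set_scope.
Local Open Scope ring_scope.

(* [Complete] extends [Pointed], so these spaces are nonempty. *)
#[short(type="completeMetricType")]
HB.structure Definition CompleteMetric (R : numDomainType) :=
  {T of Metric R T & Complete T}.

(* The library's [bounded_set] and [lipschitz] are restricted to normed spaces;
   the notions below are their metric versions. *)

Definition metric_bounded (R : realType) (T : metricType R) (S : set T) : Prop :=
  exists2 r : R, 0 <= r & forall x y, S x -> S y -> mdist x y <= r.

(* Continuity is deliberately not part of compactness of a map. *)
Definition compact_map (R : realType) (P Z : metricType R) (H : P -> Z) : Prop :=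
  forall B : set P, metric_bounded B -> compact (closure (H @` B)).

Definition locally_lipschitz (R : realType) (P Z : metricType R)
    (H : P -> Z) : Prop :=
  forall u0 : P, exists2 V : set P, nbhs u0 V &
    exists2 L : R, 0 <= L &
      forall v w, V v -> V w -> mdist (H v) (H w) <= L * mdist v w.

Section parametrized_maps.
Context (R : realType) (X P : metricType R) (F : X -> P -> X).

Definition lipschitz_unif_bounded : Prop :=
  forall B : set P, metric_bounded B ->
    exists2 L : R, 0 <= L &
      forall x y u, B u -> mdist (F x u) (F y u) <= L * mdist x y.

Definition eventual_contraction_unif_bounded : Prop :=
  forall B : set P, metric_bounded B ->
    exists (N : nat) (C : R), [/\ (1 <= N)%N, 0 <= C, C < 1 &
      forall x y u, B u ->
        mdist (iter N (F^~ u) x) (iter N (F^~ u) y) <= C * mdist x y].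

Definition locally_lipschitz_locally_unif : Prop :=
  forall (x0 : X) (u0 : P), exists (U : set X) (V : set P) (L : R),
    [/\ nbhs x0 U, nbhs u0 V, 0 <= L &
      forall x v w, U x -> V v -> V w ->
        mdist (F x v) (F x w) <= L * mdist v w].

Definition fixed_point_map (Phi : P -> X) : Prop :=
  forall u, unique (fun x => x = F x u) (Phi u).

End parametrized_maps.

(* Main.v *)
(** Let [F_u^N] be [C]-contracting and [F_u] be [L]-Lipschitz for all [u] in a
    bounded set [B].  Telescoping along [x, F_u x, ..., F_u^N x] gives, with one
    constant [K] for all [u] in [B], the a posteriori estimate
    [d(x, Phi u) <= K d(x, F x u)].  Hence, along any filter containing [B],
    [F z u --> z] implies [Phi u --> z].  For the filter [nbhs u0] and
    [z = Phi u0] this is continuity.  For an ultrafilter [U] containing [B],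
    compactness of the maps [F x] gives a limit [g x] of [F x u] along [U] for
    each [x]; [g^N] is again a [C]-contraction, so [g] has a fixed point [z], and
    [Phi] converges to [z] along [U].  Local Lipschitz continuity is the estimate
    at [x = Phi v], [u = w]. *)
Require Import Defs.
From mathcomp Require Import all_boot all_order all_algebra.
From mathcomp Require Import all_classical all_reals all_analysis.
From mathcomp Require Import ring lra.

Set Implicit Arguments.
Unset Strict Implicit.
Unset Printing Implicit Defensive.

Import Order.TTheory GRing.Theory Num.Theory.
Import numFieldNormedType.Exports.
Import metricType_numDomainType.

Local Open Scope classical_set_scope.
Local Open Scope ring_scope.

Lemma metric_bounded_ball (R : realType) (P : metricType R) (u : P) (r : R) :
  0 < r -> metric_bounded (ball u r).
Proof.
move=> r0; exists (r + r); first by rewrite addr_ge0 ?ltW.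
move=> x y; rewrite ballEmdist /= => ux uy.
by rewrite (le_trans (metric_triangle x u y))// metric_sym lerD ?ltW.
Qed.

Lemma cvg_mdist_le (R : realType) (X : metricType R) (T : Type)
    (U : set_system T) (f g : T -> X) (a b : X) (c : R) :
  ProperFilter U -> f @ U --> a -> g @ U --> b ->
  (\forall t \near U, mdist (f t) (g t) <= c) -> mdist a b <= c.
Proof.
move=> FU fa gb fgc; apply/ler_addgt0Pr => e e0.
have e2 : 0 < e / 2 by rewrite divr_gt0.
have [t [[at_ bt] ct]] :=
  filter_ex (filterI (filterI (cvgr_dist_lt fa e2) (cvgr_dist_lt gb e2)) fgc).
have := metric_triangle a (f t) b; have := metric_triangle (f t) (g t) b.
by move: at_ bt ct => /=; rewrite (metric_sym b); lra.
Qed.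

(** Go from [x] to [y] through [h x] and [h y], then absorb the middle term [C * mdist x y] on the
    left. *)
Lemma contraction_mdist_le (R : realType) (X : metricType R) (h : X -> X)
    (C : R) (x y : X) :
  C < 1 -> mdist (h x) (h y) <= C * mdist x y ->
  mdist x y <= (mdist x (h x) + mdist y (h y)) / (1 - C).
Proof.
move=> C1 hxy; rewrite ler_pdivlMr ?subr_gt0//.
have := metric_triangle x (h x) y; have := metric_triangle (h x) (h y) y.
by rewrite (metric_sym (h y) y); lra.
Qed.

Lemma contraction_fixed_point (R : realType) (X : completeMetricType R)
    (h : X -> X) (C : R) :
  0 <= C -> C < 1 -> (forall x y, mdist (h x) (h y) <= C * mdist x y) ->
  exists z, h z = z.
Proof.
move=> C0 C1 hC; pose x0 : X := point; pose y n := iter n h x0.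
have stepE n : mdist (y n) (y n.+1) <= C ^+ n * mdist x0 (h x0).
  elim: n => [|n IH]; first by rewrite expr0 mul1r.
  by rewrite (le_trans (hC _ _))// exprS -mulrA ler_wpM2l.
pose A := mdist x0 (h x0); have A0 : 0 <= A by exact: mdist_ge0.
have step0 : (fun n => C ^+ n * A) @ \oo --> (0 : R).
  rewrite -(mul0r A); apply: cvgMr_tmp.
  by apply: cvg_expr; rewrite ger0_norm.
have small (e : R) : 0 < e -> \forall n \near \oo, mdist (y n) (y n.+1) < e.
  move=> e0; have /pseudometric_normed_Zmodule.cvgrPdist_lt /(_ _ e0) := step0.
  apply: filterS => n; rewrite sub0r normrN; apply: le_lt_trans.
  exact: le_trans (stepE n) (ler_norm _).
have /cauchy_cvgP /cvg_ex [z yz] : cauchy (y @ \oo).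
  apply: cauchy_exP => e e0.
  (* Two iterates whose next steps are both below this bound are within [e] of each other by
     [contraction_mdist_le], so no geometric series has to be summed. *)
  have d0 : 0 < e * (1 - C) / 2 by rewrite divr_gt0// mulr_gt0// subr_gt0.
  have [n sn] := filter_ex (small _ d0); exists (y n).
  rewrite /=; apply: filterS (small _ d0) => m sm; rewrite ballEmdist /=.
  apply: le_lt_trans (contraction_mdist_le C1 (hC _ _)) _.
  by rewrite ltr_pdivrMr ?subr_gt0//; move: sn sm => /=; lra.
exists z; apply/esym/mdist_positivity/le_anti; rewrite mdist_ge0 andbT.
have hyz : h \o y @ \oo --> h z.
  apply/cvgrPdist_lt => e e0; apply: filterS (cvgr_dist_lt yz e0) => n.
  apply: le_lt_trans; apply: le_trans (hC _ _) _.
  by rewrite ler_piMl ?mdist_ge0 ?ltW.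
apply/ler_addgt0Pr => e e0; rewrite add0r; apply: cvg_mdist_le yz hyz _.
by apply: filterS (small _ e0) => n /ltW.
Qed.

(** If [z] is fixed by [g^N], so is [g z], since [g] commutes with its iterates; a contraction has
    only one fixed point, hence [g z = z]. *)
Lemma eventual_contraction_fixed_point (R : realType)
    (X : completeMetricType R) (g : X -> X) (N : nat) (C : R) :
  0 <= C -> C < 1 ->
  (forall x y, mdist (iter N g x) (iter N g y) <= C * mdist x y) ->
  exists z, g z = z.
Proof.
move=> C0 C1 gC; have [z gz] := contraction_fixed_point C0 C1 gC.
exists z; apply/mdist_positivity/le_anti; rewrite mdist_ge0 andbT.
apply: le_trans (contraction_mdist_le C1 (gC _ _)) _.
by rewrite -iterSr iterS gz !mdistxx addr0 mul0r.
Qed.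

Lemma mdist_iter_le (R : realType) (X : metricType R) (g : X -> X) (L : R)
    (N : nat) (x : X) :
  0 <= L -> (forall x y, mdist (g x) (g y) <= L * mdist x y) ->
  mdist x (iter N g x) <= (\sum_(k < N) L ^+ k) * mdist x (g x).
Proof.
move=> L0 gL; elim: N => [|N IH]; first by rewrite /= mdistxx big_ord0 mul0r.
have stepE : mdist (iter N g x) (iter N.+1 g x) <= L ^+ N * mdist x (g x).
  elim: N {IH} => [|n IH]; first by rewrite expr0 mul1r.
  by rewrite (le_trans (gL _ _))// exprS -mulrA ler_wpM2l.
rewrite big_ord_recr /= mulrDl.
exact: le_trans (metric_triangle _ _ _) (lerD IH stepE).
Qed.

Lemma eventual_contraction_mdist_le (R : realType) (X : metricType R)
    (g : X -> X) (L C : R) (N : nat) (x z : X) :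
  0 <= L -> C < 1 -> (forall x y, mdist (g x) (g y) <= L * mdist x y) ->
  (forall x y, mdist (iter N g x) (iter N g y) <= C * mdist x y) ->
  g z = z -> mdist x z <= (\sum_(k < N) L ^+ k) / (1 - C) * mdist x (g x).
Proof.
move=> L0 C1 gL gC gz; rewrite mulrAC.
apply: le_trans (contraction_mdist_le C1 (gC _ _)) _.
have -> : iter N g z = z by elim: N {gC} => //= n ->.
rewrite mdistxx addr0 ler_pM2r ?invr_gt0 ?subr_gt0//.
exact: mdist_iter_le.
Qed.

(** Moves the compactness test to ultrafilters on the parameters, along which the limits of [F x]
    for all [x] can be taken simultaneously. *)
Lemma ultra_compact_closure_image (R : realType) (P : Type) (Z : metricType R)
    (H : P -> Z) (B : set P) :
  (forall U, UltraFilter U -> U B -> exists z : Z, H @ U --> z) ->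
  compact (closure (H @` B)).
Proof.
move=> HU G GG GB.
(* [G] need not meet [H @` B] itself, only its closure, so the sets of [G] are
   thickened before being pulled back along [H]. *)
pose D (i : set Z * R) := G i.1 /\ 0 < i.2.
pose E (i : set Z * R) :=
  [set u | B u /\ exists2 w, i.1 w & mdist w (H u) < i.2].
have FE : ProperFilter (filter_from D E).
  apply: filter_from_proper; last first.
    move=> [S e] [/= GS e0]; have [w [Sw clw]] := filter_ex (filterI GS GB).
    have [_ [[u Bu <-]]] := clw _ (nbhsx_ballx w e e0).
    by rewrite ballEmdist /= => wu; exists u; split => //; exists w.
  apply: filter_from_filter.
    by exists (setT, 1); split => //; exact: filterT.
  move=> [S e] [S' e'] [/= GS e0] [/= GS' e'0].
  exists (S `&` S', Order.min e e').
    by split; [exact: filterI|rewrite /= lt_min e0].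
  move=> u [Bu [w [Sw S'w]]]; rewrite /= lt_min => /andP[we we'].
  by split; split => //; exists w.
have [U [UU sEU]] := ultraFilterLemma FE.
have EU S e : G S -> 0 < e -> U (E (S, e)).
  by move=> GS e0; apply: sEU; exists (S, e).
have UB : U B by apply: filterS (EU setT 1 filterT ltr01) => u [].
have [z Hz] := HU U UU UB; exists z; split.
  move=> V /Hz UV.
    have {}UV : U (H @^-1` V) := UV.
    have [u [Bu Vu]] := filter_ex (filterI UB UV).
  by exists (H u); split => //; exists u.
(* [z] is a cluster point of [G]: some [u] has [H u] close both to [z] and to a point [w] of [S]. *)
move=> S V GS /nbhs_ballP [e /= e0 zeV].
have e2 : 0 < e / 2 by rewrite divr_gt0.
have [u [zu [Bu [w Sw wu]]]] :=
  filter_ex (filterI (cvgr_dist_lt Hz e2) (EU S _ GS e2)).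
exists w; split => //; apply: zeV; rewrite ballEmdist /=.
apply: le_lt_trans (metric_triangle z (H u) w) _.
by rewrite (metric_sym (H u)); move: zu wu => /=; lra.
Qed.

(** If the preimage of [A] is not in [U], that of its complement is, so a proper filter above
    [f @ U] cannot contain [A]. *)
Lemma ultra_fmap (T T' : Type) (f : T -> T') (U : set_system T) :
  UltraFilter U -> UltraFilter (f @ U).
Proof.
move=> UU; split=> [|G GG sUG]; first exact: fmap_proper_filter.
rewrite eqEsubset; split=> // A GA.
have [//|UnA] := in_ultra_setVsetC (f @^-1` A) UU.
by have [? []] := filter_ex (filterI GA (sUG (~` A) UnA)).
Qed.

Lemma cvg_iter_lipschitz (R : realType) (X : metricType R) (P : Type)
    (F : X -> P -> X) (U : set_system P) (B : set P) (L : R) (g : X -> X)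
    (n : nat) (x : X) :
  Filter U -> U B -> 0 <= L ->
  (forall x y u, B u -> mdist (F x u) (F y u) <= L * mdist x y) ->
  (forall x, F x @ U --> g x) ->
  iter n (F^~ u) x @[u --> U] --> iter n g x.
Proof.
move=> FU UB L0 FL Fg; elim: n => [|n IH] /=; first exact: cvg_cst.
set y := iter n g x in IH *; apply/cvgrPdist_lt => e e0.
(* With [d = e / (1 + L)], convergence of [F y] costs [d] and the inductive error, magnified by
   [F_u], costs [L * d]. The added 1 covers [L = 0]. *)
have L1 : 0 < 1 + L by rewrite ltr_pwDl.
have d0 : 0 < e / (1 + L) by rewrite divr_gt0.
apply: filterS (filterI UB (filterI (cvgr_dist_lt (Fg y) d0)
  (cvgr_dist_lt IH d0))) => u [Bu [/= gyu yu]].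
apply: le_lt_trans (metric_triangle _ (F y u) _) _.
apply: le_lt_trans (lerD (lexx _) (FL _ _ _ Bu)) _.
have -> : e = e / (1 + L) + L * (e / (1 + L)) by field; lra.
by rewrite ltr_leD// ler_wpM2l// ltW.
Qed.

Section FixedPointMap.
Context (R : realType) (X P : completeMetricType R) (F : X -> P -> X).
Context (Phi : P -> X) (PhiE : forall u, F (Phi u) u = Phi u).
Context (Fa : lipschitz_unif_bounded F).
Context (Fb : eventual_contraction_unif_bounded F).

Lemma fixed_point_map_mdist_le (B : set P) : metric_bounded B ->
  exists2 K : R, 0 <= K &
    forall x u, B u -> mdist x (Phi u) <= K * mdist x (F x u).
Proof.
move=> bB; have [L L0 FL] := Fa bB; have [N [C [N1 C0 C1 FC]]] := Fb bB.
exists ((\sum_(k < N) L ^+ k) / (1 - C)).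
  apply: divr_ge0; last by rewrite subr_ge0 ltW.
  by apply: sumr_ge0 => k _; exact: exprn_ge0.
move=> x u Bu.
by apply: (@eventual_contraction_mdist_le _ _ (F^~ u) L C N) => // *;
  [exact: FL|exact: FC].
Qed.

Lemma fixed_point_map_cvg (B : set P) (U : set_system P) (z : X) :
  Filter U -> metric_bounded B -> U B -> F z @ U --> z -> Phi @ U --> z.
Proof.
move=> FU bB UB Fz; have [K K0 PhiK] := fixed_point_map_mdist_le bB.
apply/cvgrPdist_lt => e e0.
have K1 : 0 < 1 + K by rewrite ltr_pwDl.
have d0 : 0 < e / (1 + K) by rewrite divr_gt0.
apply: filterS (filterI UB (cvgr_dist_lt Fz d0)) => u [Bu].
rewrite ltr_pdivlMr// => zu; apply: le_lt_trans (PhiK z u Bu) _.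
by have := mdist_ge0 z (F z u); move: zu => /=; lra.
Qed.

Lemma fixed_point_map_continuous :
  (forall x, continuous (F x)) -> continuous Phi.
Proof.
move=> Fc u0; apply: (@fixed_point_map_cvg (ball u0 1)).
- exact: metric_bounded_ball.
- exact: nbhsx_ballx.
- by rewrite -{2}(PhiE u0); exact: Fc.
Qed.

Lemma fixed_point_map_compact :
  (forall x, compact_map (F x)) -> compact_map Phi.
Proof.
move=> Fd B bB; apply: ultra_compact_closure_image => U UU UB.
have limF x : exists z : X, F x @ U --> z.
  have FxB : U (F x @^-1` closure (F x @` B)).
    by apply: filterS UB => u Bu; apply: subset_closure; exists u.
  have := Fd x B bB; rewrite compact_ultra.
  by move=> /(_ _ (ultra_fmap (F x) UU) FxB) [z [_ Fz]]; exists z.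
have [g Fg] := choice limF.
have [L L0 FL] := Fa bB; have [N [C [N1 C0 C1 FC]]] := Fb bB.
have itF x : iter N (F^~ u) x @[u --> U] --> iter N g x.
  exact: cvg_iter_lipschitz UB L0 FL Fg.
have [z gz] : exists z, g z = z.
  apply: (@eventual_contraction_fixed_point _ _ _ N C) => // x y.
  (* The constant [C] is common to all [u] in [B], so the contraction inequality survives the limit
     along [U]. *)
  apply: cvg_mdist_le (itF x) (itF y) _.
  by apply: filterS UB => u; exact: FC.
exists z; apply: (@fixed_point_map_cvg B) => //; rewrite -{2}gz; exact: Fg.
Qed.

Lemma fixed_point_map_locally_lipschitz :
  continuous Phi -> locally_lipschitz_locally_unif F -> locally_lipschitz Phi.
Proof.
move=> cPhi Fe u0; have [U [V [L [nU nV L0 FL]]]] := Fe (Phi u0) u0.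
have [K K0 PhiK] := fixed_point_map_mdist_le (metric_bounded_ball u0 ltr01).
(* The first two factors allow (e) at the point [Phi v]; the ball is a bounded set on which [K] is
   valid. *)
exists (V `&` Phi @^-1` U `&` ball u0 1).
  apply: filterI; last exact: nbhsx_ballx.
  by apply: filterI => //; exact: cPhi.
exists (K * L); first exact: mulr_ge0.
move=> v w [[Vv Uv] _] [[Vw _] bw]; apply: le_trans (PhiK _ _ bw) _.
by rewrite -mulrA ler_wpM2l// -{1}(PhiE v) FL.
Qed.

End FixedPointMap.

Theorem corollary2p9 (R : realType) (X P : completeMetricType R)
  (F : X -> P -> X)
  (Fa : lipschitz_unif_bounded F)
  (Fb : eventual_contraction_unif_bounded F)
  (Fc : forall x : X, continuous (F x))
  (Fd : forall x : X, compact_map (F x)) :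
  exists Phi : P -> X,
    [/\ fixed_point_map F Phi,
        continuous Phi,
        compact_map Phi
      & locally_lipschitz_locally_unif F -> locally_lipschitz Phi].
Proof.
have exF u : exists z, F z u = z.
  have [N [C [_ C0 C1 FC]]] := Fb _ (metric_bounded_ball u ltr01).
  apply: (@eventual_contraction_fixed_point _ _ (F^~ u) N C) => // x y.
  by apply: FC; exact: ballxx.
have [Phi PhiE] := choice exF; exists Phi.
have cPhi := fixed_point_map_continuous PhiE Fa Fb Fc.
split=> //; last 2 first.
- exact: fixed_point_map_compact.
- exact: fixed_point_map_locally_lipschitz.
move=> u; split=> [|x xE]; first by rewrite PhiE.
(* Uniqueness: at any fixed point [x] of [F_u] the right-hand side of the estimate vanishes. *)
have [K K0 PhiK] := fixed_point_map_mdist_le PhiE Fa Fb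
  (metric_bounded_ball u ltr01).
apply/esym/mdist_positivity/le_anti; rewrite mdist_ge0 andbT.
by rewrite (le_trans (PhiK _ _ (ballxx _ ltr01)))// -xE mdistxx mulr0.
Qed.
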